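(* Let $F$ satisfy the DLRA assumptions and the affine assumption described in the context, and let $E_n^k = X_n - Y_n^k$ be the error of low-rank Parareal with coarse rank $q$, fine rank $r$ ($q<r$) and step size $h$. Put $$\alpha = e^{\ell h} C_{r,q},\qquad \beta = e^{\ell h} C_q,\qquad \kappa = e^{\ell h}\max_{n\ge 0}\|X_n-\mathcal{T}_r(X_n)\| + (2\varepsilon_q+\varepsilon_r)\int_0^h e^{\ell(h-s)}\,ds .$$ If $\alpha+\beta<1$, then low-rank Parareal satisfies for all $k\in\mathbb{N}$ the linear bound $$\max_{n\ge 0}\|E_n^k\| \le \left(\frac{\alpha}{1-\beta}\right)^k \max_{n\ge 0}\|E_n^0\| + \frac{\kappa}{1-\alpha-\beta}.$$
   Context: Notation: $\|\cdot\|$ is the Frobenius norm on $\mathbb{R}^{m\times m}$ and $\langle\cdot,\cdot\rangle$ the corresponding inner product. A superscript $k$ on $Y,E$ is an iteration index, not a power; $\alpha^k$ and $(\alpha/(1-\beta))^k$ denote powers. Full problem: $\dot X(t)=F(X(t))$ on $[0,T]$, $X(0)=X_0\in\mathbb{R}^{m\times m}$, with constant time step $h$, $T=Nh$, $t_n=nh$ and $X_n=X(t_n)$. The index $n$ is the time-step index. Affine assumption: $F$ is affine linear and autonomous, $F(X)=A(X)+B$ with $A:\mathbb{R}^{m\times m}\to\mathbb{R}^{m\times m}$ a linear operator and $B\in\mathbb{R}^{m\times m}$. DLRA: for a rank $p$, let $\mathcal{M}_p$ be the manifold of $m\times m$ matrices of rank $p$, and for $Y\in\mathcal{M}_p$ let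 $\mathcal{P}_Y$ be the $l_2$-orthogonal projection onto the tangent space of $\mathcal{M}_p$ at $Y$. The dynamical low-rank approximation (DLRA) of rank $p$ is the solution of $\dot Y(t)=\mathcal{P}_{Y(t)}F(Y(t))$ with initial value in $\mathcal{M}_p$; $\psi_p^h(Z)$ denotes this solution at time $h$ with initial value $Z$. $\mathcal{T}_p$ denotes the orthogonal projection onto $\mathcal{M}_p$ (truncated SVD). DLRA assumptions: for all $X,Y\in\mathbb{R}^{m\times m}$, $\|F(X)-F(Y)\|\le L\|X-Y\|$ (Lipschitz with constant $L$) and $\langle X-Y,F(X)-F(Y)\rangle\le \ell\|X-Y\|^2$ (one-sided Lipschitz with constant $\ell$); and, for $p\in\{q,r\}$, $\|F(Y)-\mathcal{P}_YF(Y)\|\le\varepsilon_p$ for $Y\in\mathcal{M}_p$ (modeling error). Low-rank Parareal: for ranks $q<r$ and a given initial matrix $Y_0$, the iterates $Y_n^k$ are defined by $Y_0^k=Y_0$; $Y_{n+1}^0=\psi_q^h(\mathcal{T}_q(Y_n^0))+\mathcal{E}_n$, where the matrices $\mathcal{E}_n$ are small perturbations such that $\mathrm{rank}(Y_{n+1}^0)=r+2q$ and can be chosen randomly; and $$Y_{n+1}^{k+1}=\psi_r^h(\mathcal{T}_r(Y_n^k))+\psi_q^h(\mathcal{T}_q(Y_n^{k+1}))-\psi_q^h(\mathcal{T}_q(Y_n^k)).$$ Lipschitz constants: $C_{r,q}$ and $C_q$ are the Lipschitz constants of $\mathcal{T}_r-\mathcal{T}_q$ and of $\mathcal{T}_q$,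 respectively.
   Formalization: Adds ‖X_0−Y_0‖ ≤ κ/(1−α−β), necessary since E_0^k = X_0−Y_0 never decays in k (false for F=−id, X_0=0, Y_0≠0); holds if Y_0=X_0. Lipschitz constants are only needed on a set containing X_n, Y_n^k; the DLRA solutions used are assumed to exist. *)

(* Defs.v *)
From HB Require Import structures.
From mathcomp Require Import all_boot all_order all_algebra.
From mathcomp Require Import all_classical all_reals all_analysis.

Set Implicit Arguments.
Unset Strict Implicit.
Unset Printing Implicit Defensive.

Import Order.TTheory GRing.Theory Num.Theory.
Import numFieldNormedType.Exports.

Local Open Scope classical_set_scope.
Local Open Scope ring_scope.

(* The norm [`|X|] that MathComp-Analysis puts on matrices is the maximum norm.
   It is used below only for the topology and for derivatives, which do not
   depend on the choice of norm; all estimates are in the Frobenius norm. *)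
Definition finner (R : realType) (m : nat) (X Y : 'M[R]_m) : R :=
  \sum_i \sum_j X i j * Y i j.

Definition fnorm (R : realType) (m : nat) (X : 'M[R]_m) : R :=
  Num.sqrt (finner X X).

Definition flipschitz (R : realType) (m : nat) (D : set 'M[R]_m) (C : R)
    (G : 'M[R]_m -> 'M[R]_m) : Prop :=
  0 <= C /\
  forall X Y, D X -> D Y -> fnorm (G X - G Y) <= C * fnorm (X - Y).

Definition one_sided_lipschitz (R : realType) (m : nat) (ell : R)
    (F : 'M[R]_m -> 'M[R]_m) : Prop :=
  forall X Y, finner (X - Y) (F X - F Y) <= ell * fnorm (X - Y) ^+ 2.

(* On [0, T] the derivative is required in the interior only, together with
   continuity up to the end points. *)
Definition ode_solution (R : realType) (m : nat) (G : 'M[R]_m -> 'M[R]_m)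
    (T : R) (X0 : 'M[R]_m) (X : R -> 'M[R]_m) : Prop :=
  [/\ X 0 = X0,
      {within `[0, T], continuous X} &
      forall t : R, 0 < t < T -> is_derive t 1 X (G (X t))].

Definition rank_manifold (R : realType) (m p : nat) : set 'M[R]_m :=
  [set Y | \rank Y = p].

(* Velocities of C^1 curves that stay in the manifold. *)
Definition tangent_space (R : realType) (m p : nat) (Y : 'M[R]_m) :
    set 'M[R]_m :=
  [set V | exists c : R -> 'M[R]_m,
    [/\ c 0 = Y,
        \forall t \near (0 : R),
          [/\ rank_manifold p (c t), derivable c t 1
            & {for t, continuous (derive1 c)}] &
        derive1 c 0 = V]].

(* The default value 0 is never taken when Y has rank p: the tangent space is
   then a linear subspace of a finite-dimensional space. *)
Definition tangent_proj (R : realType) (m p : nat) (Y Z : 'M[R]_m) : 'M[R]_m :=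
  xget 0 [set V | tangent_space p Y V /\
                  forall W, tangent_space p Y W -> finner (Z - V) W = 0].

Definition modeling_error (R : realType) (m : nat) (F : 'M[R]_m -> 'M[R]_m)
    (p : nat) (eps : R) : Prop :=
  forall Y, rank_manifold p Y -> fnorm (F Y - tangent_proj p Y (F Y)) <= eps.

Definition dlra_solution (R : realType) (m : nat) (F : 'M[R]_m -> 'M[R]_m)
    (p : nat) (h : R) (Z : 'M[R]_m) (Y : R -> 'M[R]_m) : Prop :=
  (forall t : R, 0 <= t <= h -> rank_manifold p (Y t)) /\
  ode_solution (fun W => tangent_proj p W (F W)) h Z Y.

(* The solution may leave the manifold before time h, so its existence is a
   genuine condition on the initial value Z. *)
Definition dlra_exists (R : realType) (m : nat) (F : 'M[R]_m -> 'M[R]_m)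
    (p : nat) (h : R) (Z : 'M[R]_m) : Prop :=
  exists Y, dlra_solution F p h Z Y.

(* The value at time h of the DLRA solution with initial value Z; meaningful
   under [dlra_exists F p h Z]. *)
Definition dlra_flow (R : realType) (m : nat) (F : 'M[R]_m -> 'M[R]_m)
    (p : nat) (h : R) (Z : 'M[R]_m) : 'M[R]_m :=
  xget 0 [set W | exists2 Y, dlra_solution F p h Z Y & W = Y h].

(* W is obtained from a singular value decomposition Z = U diag(s) V^T with
   nonincreasing s by keeping the p leading singular values. W is not unique
   when the p-th and (p+1)-st singular values of Z agree, and W = Z when Z has
   rank less than p. *)
Definition truncated_svd (R : realType) (m p : nat) (Z W : 'M[R]_m) : Prop :=
  exists (U V : 'M[R]_m) (s : 'rV[R]_m),
    [/\ U^T *m U = 1%:M /\ V^T *m V = 1%:M,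
        forall i, 0 <= s 0 i,
        forall i j : 'I_m, (i <= j)%N -> s 0 j <= s 0 i,
        Z = U *m diag_mx s *m V^T &
        W = U *m diag_mx (\row_i (if (i < p)%N then s 0 i else 0)) *m V^T].

(* [Y n k] is the iterate at time step n and iteration k, [Tr p] the rank-p
   truncation and [Pert n] the perturbation added in the initial coarse sweep.
   The second field says that every DLRA problem the method solves has a
   solution. *)
Record lowrank_parareal (R : realType) (m : nat) (F : 'M[R]_m -> 'M[R]_m)
    (Tr : nat -> 'M[R]_m -> 'M[R]_m) (q r : nat) (h : R) (N : nat)
    (Y0 : 'M[R]_m) (Pert : nat -> 'M[R]_m) (Y : nat -> nat -> 'M[R]_m) :
    Prop := LowrankParareal {
  parareal_init : forall k, Y 0%N k = Y0;
  parareal_defined : forall n k, (n < N)%N ->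
    dlra_exists F q h (Tr q (Y n k)) /\ dlra_exists F r h (Tr r (Y n k));
  parareal_coarse : forall n, (n < N)%N ->
    Y n.+1 0%N = dlra_flow F q h (Tr q (Y n 0%N)) + Pert n;
  parareal_rank : forall n, (n < N)%N -> \rank (Y n.+1 0%N) = (r + 2 * q)%N;
  parareal_iter : forall n k, (n < N)%N ->
    Y n.+1 k.+1 = dlra_flow F r h (Tr r (Y n k))
                  + dlra_flow F q h (Tr q (Y n k.+1))
                  - dlra_flow F q h (Tr q (Y n k))
}.

Definition max_steps (R : realType) (N : nat) (f : nat -> R) : R :=
  \big[Order.max/0]_(n < N.+1) f n.

(* Main.v *)
Require Import Defs.
From HB Require Import structures.
From mathcomp Require Import all_boot all_order all_algebra.
From mathcomp Require Import all_classical all_reals all_analysis.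
From mathcomp Require Import ring lra.

(** The exact value X (t_n + h) and the Parareal update are never compared
    through the exact flow.  Instead, write x for the exact solution on one
    time step, yr for the fine low-rank solution started at Tr r (Y n k), and
    wq, yq for the coarse ones started at Tr q (Y n k.+1) and Tr q (Y n k).
    The four coefficients in D = x - yr - wq + yq add up to 0, so for an affine
    F the constant B disappears and
      D' = A D + (residuals of the three low-rank solutions),
    where the residuals F Y - tangent_proj Y (F Y) have total norm at most
    2 eps_q + eps_r.  The one-sided Lipschitz condition bounds <D, A D> by
    ell |D|^2, and a Gronwall estimate for |D| ([gronwall], used in
    [parareal_defect_le]) gives
      |E n.+1 k.+1| <= e^(ell h) |D 0|
                       + (2 eps_q + eps_r) int_0^h e^(ell (h-s)) ds.
    Here D 0 = X_n - Tr r (Y n k) - Tr q (Y n k.+1) + Tr q (Y n k) is the sum of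
    X_n - Tr r X_n, of the increment of Tr r - Tr q between Y n k and X_n, and
    of the increment of Tr q between Y n k.+1 and X_n.  Hence
      |E n.+1 k.+1| <= alpha |E n k| + beta |E n k.+1| + kappa.

    What remains is about real sequences ([parareal_recursion_bound]): K =
    kappa / (1 - alpha - beta) is the fixed point of z |-> (alpha + beta) z
    + kappa, and rho = alpha / (1 - beta) solves rho = alpha + beta rho, so
    rho^k M + K, with M = max_n |E n 0|, is reproduced exactly by the
    recursion. A double induction on k and n therefore keeps |E n k| below
    it; the induction on n starts from the error of the initial value, which
    does not decrease with k and must be at most K. *)

Import Order.TTheory GRing.Theory Num.Theory.
Import numFieldNormedType.Exports.
Local Open Scope classical_set_scope.
Local Open Scope ring_scope.

(** * The Frobenius inner product *)

Section frobenius.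
Context {R : realType} {m : nat}.
Implicit Types (X Y Z : 'M[R]_m) (a : R).

Lemma finnerC X Y : finner X Y = finner Y X.
Proof. by apply: eq_bigr => i _; apply: eq_bigr => j _; rewrite mulrC. Qed.

Lemma finnerDl X Y Z : finner (X + Y) Z = finner X Z + finner Y Z.
Proof.
rewrite -big_split; apply: eq_bigr => i _; rewrite -big_split.
by apply: eq_bigr => j _; rewrite !mxE mulrDl.
Qed.

Lemma finnerZl a X Y : finner (a *: X) Y = a * finner X Y.
Proof.
rewrite mulr_sumr; apply: eq_bigr => i _; rewrite mulr_sumr.
by apply: eq_bigr => j _; rewrite !mxE mulrA.
Qed.

Lemma finnerDr X Y Z : finner X (Y + Z) = finner X Y + finner X Z.
Proof. by rewrite finnerC finnerDl !(finnerC X). Qed.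

Lemma finnerZr a X Y : finner X (a *: Y) = a * finner X Y.
Proof. by rewrite finnerC finnerZl finnerC. Qed.

Lemma finner_ge0 X : 0 <= finner X X.
Proof. by do 2!apply: sumr_ge0 => ? _; rewrite -expr2 sqr_ge0. Qed.

Lemma finner_eq0 X : finner X X = 0 -> X = 0.
Proof.
move=> /eqP; rewrite psumr_eq0 => [/allP h|i _]; last first.
  by apply: sumr_ge0 => j _; rewrite -expr2 sqr_ge0.
apply/matrixP => i j; rewrite mxE; have := h i (mem_index_enum _).
rewrite /= psumr_eq0 => [/allP/(_ j (mem_index_enum _))|k _]; last first.
  by rewrite -expr2 sqr_ge0.
by rewrite /= -expr2 sqrf_eq0 => /eqP.
Qed.

Lemma fnorm_ge0 X : 0 <= fnorm X.
Proof. exact: sqrtr_ge0. Qed.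

Lemma sqr_fnorm X : fnorm X ^+ 2 = finner X X.
Proof. by rewrite sqr_sqrtr ?finner_ge0. Qed.

Lemma fnormN X : fnorm (- X) = fnorm X.
Proof. by rewrite /fnorm -scaleN1r finnerZl finnerZr !mulN1r opprK. Qed.

(** Cauchy-Schwarz: expand the squared norm of <Y,Y> X - <X,Y> Y and divide by
    <Y,Y>. *)
Lemma finner_le X Y : finner X Y <= fnorm X * fnorm Y.
Proof.
have [->|Y0] := eqVneq Y 0.
  by rewrite -(scale0r (0 : 'M[R]_m)) finnerZr mul0r mulr_ge0 ?fnorm_ge0.
have yy0 : 0 < finner Y Y.
  rewrite lt_def finner_ge0 andbT; apply: contra_neq Y0; exact: finner_eq0.
apply: le_trans (ler_norm _) _.
rewrite -(@ler_pXn2r _ 2) ?nnegrE ?mulr_ge0 ?fnorm_ge0//.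
rewrite real_normK ?num_real// exprMn !sqr_fnorm -subr_ge0 -(pmulr_rge0 _ yy0).
have := finner_ge0 (finner Y Y *: X + (- finner X Y) *: Y).
rewrite !(finnerDl, finnerDr, finnerZl, finnerZr) (finnerC Y X).
by move/le_trans; apply; rewrite le_eqVlt; apply/orP; left; apply/eqP; ring.
Qed.

Lemma fnormD X Y : fnorm (X + Y) <= fnorm X + fnorm Y.
Proof.
rewrite -(@ler_pXn2r _ 2) ?nnegrE ?addr_ge0 ?fnorm_ge0//.
rewrite sqr_fnorm !(finnerDl, finnerDr) (finnerC Y X) sqrrD !sqr_fnorm.
by have := finner_le X Y; lra.
Qed.

Lemma fnormB X Y : fnorm (X - Y) <= fnorm X + fnorm Y.
Proof. by rewrite -(fnormN Y) fnormD. Qed.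

(** The topology on matrices is that of the maximum norm, so continuity and
    differentiability of the Frobenius norm squared go through coordinates. *)
Lemma continuous_finner : continuous (fun X : 'M[R]_m => finner X X).
Proof.
apply: continuous_big => [|i _]; first exact: add_continuous.
apply: continuous_big => [|j _ X]; first exact: add_continuous.
by apply: continuousM; exact: coord_continuous.
Qed.

Lemma is_derive_coord {t : R} {D : R -> 'M[R]_m} {V : 'M[R]_m} i j :
  is_derive t 1 D V -> is_derive t 1 (fun s => D s i j) (V i j).
Proof.
move=> [Dt <-]; apply: DeriveDef; first by move/derivable_mxP : Dt.
by rewrite derive_mx// mxE.
Qed.

Lemma is_derive_finner {t : R} {D : R -> 'M[R]_m} {V : 'M[R]_m} :
  is_derive t 1 D V ->
  is_derive t 1 (fun s => finner (D s) (D s)) (2 * finner (D t) V).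
Proof.
move=> Dt; have Dij i j := is_derive_coord i j Dt.
have -> : (fun s => finner (D s) (D s)) =
    \sum_i \sum_j ((fun s => D s i j) * (fun s => D s i j)).
  apply/funext => s; rewrite fct_sumE; apply: eq_bigr => i _.
  by rewrite fct_sumE.
apply: is_derive_eq; rewrite mulr_sumr; apply: eq_bigr => i _.
rewrite mulr_sumr; apply: eq_bigr => j _ /=.
by rewrite /GRing.scale/=; ring.
Qed.

End frobenius.

(** * A Gronwall estimate in the Frobenius norm *)

Section gronwall.
Context {R : realType}.

Lemma is_derive_expRN (l t : R) :
  is_derive t 1 (fun s => expR (- (l * s))) (- l * expR (- (l * t))).
Proof.
have -> : (fun s => expR (- (l * s))) = expR \o (- l *: id).
  by apply/funext => s; rewrite /= -mulNr.
have de : is_derive t 1 (expR \o (- l *: id)) (expR (- l * t) * (- l * 1)).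
  exact: is_derive1_comp.
by apply: is_derive_eq; rewrite mulr1 mulrC -[- (l * t)]mulNr.
Qed.

(** The case l = 0 is separate because the usual primitive has l in its
    denominator. *)
Lemma exp_primitive (l : R) :
  exists2 J : R -> R, J 0 = 0 &
    forall t : R, is_derive t 1 J (expR (- (l * t))).
Proof.
have [->|l0] := eqVneq l 0.
  by exists id => // t; rewrite mul0r oppr0 expR0; exact: is_derive_id.
exists (l^-1 *: (cst 1 - (fun s => expR (- (l * s))))) => [|t].
  by rewrite !fctE mulr0 oppr0 expR0 subrr scaler0.
have dE := is_derive_expRN l t.
apply: is_derive_eq; rewrite /GRing.scale/= sub0r mulNr opprK.
by rewrite mulKf.
Qed.

Lemma integral_exp {l h : R} {J : R -> R} : 0 < h -> J 0 = 0 ->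
  (forall t : R, is_derive t 1 J (expR (- (l * t)))) ->
  \int[lebesgue_measure]_(s in `[0, h]) expR (l * (h - s)) =
    expR (l * h) * J h.
Proof.
move=> h0 J0 dJ.
have dG (t : R) :
    is_derive t 1 (fun s => expR (l * h) * J s) (expR (l * (h - t))).
  apply: is_derive_eq.
  by rewrite /GRing.scale/= -expRD mulrBr.
have cG (t : R) : {for t, continuous (fun s => expR (l * h) * J s)}.
  by apply: differentiable_continuous; apply/derivable1_diffP; case: (dG t).
rewrite /Rintegral (@continuous_FTC2 _ _ (fun s => expR (l * h) * J s))//=.
- by rewrite J0 mulr0 subr0.
- apply: continuous_subspaceT => t; apply: continuous_comp; last first.
    exact: continuous_expR.
  apply: continuousM; first exact: cvg_cst.
  by apply: continuousB => //; exact: cvg_cst.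
- split=> [t _| |]; first by case: (dG t).
    by apply: cvg_at_right_filter; exact: cG.
  by apply: cvg_at_left_filter; exact: cG.
- by move=> t _; rewrite derive1E; case: (dG t).
Qed.

(** The norm of D need not be differentiable where D vanishes, so the proof
    regularizes it: u = sqrt (|D|^2 + d^2) is smooth, satisfies
    u' <= l u + (e + |l| d), and thus e^(-lt) u - (e + |l| d) int_0^t e^(-ls) ds
    is nonincreasing.  Then d tends to 0. *)
Lemma gronwall (m : nat) (D D' : R -> 'M[R]_m) (l e h : R) :
  0 < h -> 0 <= e -> {within `[0, h], continuous D} ->
  (forall t : R, 0 < t < h -> is_derive t 1 D (D' t)) ->
  (forall t : R, 0 < t < h ->
     finner (D t) (D' t) <= l * fnorm (D t) ^+ 2 + e * fnorm (D t)) ->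
  fnorm (D h) <= expR (l * h) * fnorm (D 0)
    + e * \int[lebesgue_measure]_(s in `[0, h]) expR (l * (h - s)).
Proof.
move=> h0 e0 cD dD leD.
have [J J0 dJ] := exp_primitive l.
rewrite (integral_exp h0 J0 dJ).
have cJ : {within `[0, h], continuous J}.
  apply: continuous_subspaceT => t; apply: differentiable_continuous.
  by apply/derivable1_diffP; case: (dJ t).
pose x := expR (l * h); pose c (d : R) := e + `|l| * d.
(* x * J h is the integral in the conclusion, and k the slope in d. *)
suff main (d : R) : 0 < d ->
    fnorm (D h) <= x * (fnorm (D 0) + d) + c d * (x * J h).
  apply/ler_addgt0Pr => y y0.
  pose k := x + `|l| * (x * J h).
  have k1 : 0 < `|k| + 1 by rewrite ltr_wpDl.
  pose z := y / (`|k| + 1).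
  have yk0 : 0 < z by rewrite divr_gt0.
  apply: le_trans (main _ yk0) _; rewrite /c.
  have : k * z <= y.
    rewrite /z mulrCA ger_pMr// ler_pdivrMr// mul1r.
    by apply: le_trans (ler_norm _) _; rewrite lerDl.
  by rewrite {1}/k -/x; lra.
move=> d0.
pose g t := finner (D t) (D t) + d ^+ 2.
pose u t := Num.sqrt (g t).
have g0 t : 0 < g t by rewrite ltr_wpDl ?finner_ge0// exprn_gt0.
have u0 t : 0 < u t by rewrite sqrtr_gt0.
have uu t : u t ^+ 2 = fnorm (D t) ^+ 2 + d ^+ 2.
  by rewrite sqr_sqrtr ?(ltW (g0 _))// sqr_fnorm.
have nu t : fnorm (D t) <= u t.
  rewrite -(@ler_pXn2r _ 2) ?nnegrE ?fnorm_ge0 ?(ltW (u0 _))//.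
  by rewrite uu lerDl sqr_ge0.
have du t : d <= u t.
  rewrite -(@ler_pXn2r _ 2) ?nnegrE ?(ltW d0) ?(ltW (u0 _))//.
  by rewrite uu lerDr sqr_ge0.
have und : u 0 <= fnorm (D 0) + d.
  rewrite -(@ler_pXn2r _ 2) ?nnegrE ?addr_ge0 ?fnorm_ge0 ?(ltW d0)
    ?(ltW (u0 _))//.
  by rewrite uu sqrrD; have := fnorm_ge0 (D 0); nra.
pose v : R -> R := (fun t => expR (- (l * t))) * u - c d *: J.
have dv (t : R) : 0 < t < h -> is_derive t 1 v
    (expR (- (l * t)) * (finner (D t) (D' t) / u t - l * u t - c d)).
  move=> th; have dE := is_derive_expRN l t.
  have dg := is_derive_finner (dD t th).
  have du' : is_derive t 1 u ((2 * u t)^-1 * (2 * finner (D t) (D' t) + 0)).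
    apply: (@is_derive1_comp _ Num.sqrt g); exact: is_derive1_sqrt.
  apply: is_derive_eq; rewrite /GRing.scale/= addr0.
  by field; rewrite gt_eqF.
(* If l < 0 then l |D|^2 exceeds l u^2 by |l| d^2, which is at most |l| d u:
   this is where the extra term of [c d] comes from. *)
have v'0 (t : R) : 0 < t < h ->
    finner (D t) (D' t) / u t - l * u t - c d <= 0.
  move=> th; rewrite -addrA -opprD subr_le0 ler_pdivrMr//.
  apply: le_trans (leD t th) _; rewrite /c.
  have := nu t; have := uu t; have := u0 t; have := du t.
  have := fnorm_ge0 (D t); move: (u t) (fnorm (D t)) => U n n0 dU U0 UU nU.
  have -> : l * n ^+ 2 = l * U ^+ 2 - l * d ^+ 2 by rewrite UU; ring.
  have : - l * d ^+ 2 <= `|l| * d * U.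
    apply: (@le_trans _ _ (`|l| * d ^+ 2)).
      by rewrite ler_wpM2r ?sqr_ge0// -normrN ler_norm.
    by rewrite expr2 mulrA ler_wpM2l// mulr_ge0// ltW.
  have : e * n <= e * U by exact: ler_wpM2l.
  by lra.
have cv : {within `[0, h], continuous v}.
  move=> t; apply: continuousB; last first.
    by apply: continuousM; [exact: cst_continuous|exact: cJ].
  apply: continuousM.
    apply: continuous_subspaceT => r; apply: differentiable_continuous.
    by apply/derivable1_diffP; case: (is_derive_expRN l r).
  suff: {within `[0, h], continuous
      ((fun Z => Num.sqrt (finner Z Z + d ^+ 2)) \o D)} by exact.
  apply: within_continuous_comp cD => z _.
  apply: continuous_comp; last exact: sqrt_continuous.
  by apply: continuousD; [exact: continuous_finner|exact: cst_continuous].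
have : v h <= v 0.
  apply: (@ler0_derive1_le_cc _ v 0 h) => //; rewrite ?in_itv/= ?lexx ?ltW//.
    by move=> t; rewrite in_itv/= => th; case: (dv t th).
  move=> t; rewrite in_itv/= => th.
  rewrite derive1E; case: (dv t th) => _ ->.
  by rewrite pmulr_rle0 ?expR_gt0// v'0.
rewrite /v !fctE J0 scaler0 subr0 mulr0 oppr0 expR0 mul1r.
rewrite /GRing.scale/= => vle.
have xE : x * expR (- (l * h)) = 1 by rewrite -expRD subrr expR0.
apply: le_trans (nu h) _.
have -> : u h = x * (expR (- (l * h)) * u h) by rewrite mulrA xE mul1r.
apply: (@le_trans _ _ (x * (u 0 + c d * J h))).
  by rewrite ler_wpM2l ?expR_ge0// -lerBlDr.
rewrite mulrDr [c d * (x * _)]mulrCA lerD2r.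
by rewrite ler_wpM2l ?expR_ge0.
Qed.

End gronwall.

(** * The error of one Parareal step *)

Lemma ode_solution_shift {R : realType} {m : nat} {G : 'M[R]_m -> 'M[R]_m}
    {T : R} {X0 : 'M[R]_m} {X : R -> 'M[R]_m} {a h : R} :
  0 <= a -> a + h <= T -> ode_solution G T X0 X ->
  ode_solution G h (X a) (fun t => X (a + t)).
Proof.
move=> a0 ahT [_ cX dX]; split; first by rewrite addr0.
  move/subspace_continuousP : cX => cX.
  apply/subspace_continuousP => t; rewrite /= in_itv/= => /andP[t0 th].
  have aT s : 0 <= s -> s <= h -> 0 <= a + s <= T.
    by move=> s0 sh; rewrite addr_ge0//=; apply: le_trans ahT; rewrite lerD2l.
  have cXt : X x @[x --> within `[0, T] (nbhs (a + t))] --> X (a + t).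
    by apply: cX; rewrite /= in_itv/= aT.
  apply: (cvg_comp (fun s => a + s) X _ cXt) => B wB.
  have sc : (a + s) @[s --> t] --> a + t.
    by apply: cvgD; [exact: cvg_cst|exact: cvg_id].
  suff : \forall s \near t, `[0, h]%classic s -> B (a + s) by exact.
  have : \forall s \near t, `[0, T]%classic (a + s) -> B (a + s).
    exact: sc wB.
  apply: filterS => s sB.
  by rewrite /= in_itv/= => /andP[s0 sh]; apply: sB; rewrite /= in_itv/= aT.
move=> t /andP[t0 th].
have [dXt <-] : is_derive (a + t) 1 X (G (X (a + t))).
  apply: dX; rewrite ltr_wpDl//=.
  by apply: lt_le_trans ahT; rewrite ltrD2l.
have E : (fun s : R => s^-1 *: (((fun t => X (a + t)) \o shift t) (s *: 1)
    - X (a + t))) = (fun s => s^-1 *: ((X \o shift (a + t)) (s *: 1)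
    - X (a + t))).
  by apply/funext => s /=; rewrite addrCA.
by apply: DeriveDef; rewrite /derivable /derive E.
Qed.

Lemma dlra_flowP {R : realType} {m : nat} {F : 'M[R]_m -> 'M[R]_m} {p : nat}
    {h : R} {Z : 'M[R]_m} :
  dlra_exists F p h Z ->
  exists2 Y, dlra_solution F p h Z Y & dlra_flow F p h Z = Y h.
Proof.
move=> [Y solY].
have : exists W, exists2 Y, dlra_solution F p h Z Y & W = Y h.
  by exists (Y h), Y.
exact: xgetPex.
Qed.

(** Gronwall needs nonnegative residual bounds; a point on the manifold
    provides this. *)
Lemma modeling_error_ge0 {R : realType} {m : nat} {F : 'M[R]_m -> 'M[R]_m}
    {p : nat} {eps : R} {Y : 'M[R]_m} :
  modeling_error F p eps -> rank_manifold p Y -> 0 <= eps.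
Proof. by move=> FY /FY; apply: le_trans; exact: fnorm_ge0. Qed.

(** The combination D of the exact and the three low-rank solutions solves the
    linear equation D' = A D up to the residuals, so its growth over a step is
    controlled by its initial value and the modeling errors. *)
Lemma parareal_defect_le {R : realType} {m : nat} {F : 'M[R]_m -> 'M[R]_m}
    {A : {linear 'M[R]_m -> 'M[R]_m}} {B : 'M[R]_m} {h ell eps_q eps_r : R}
    {q r : nat} {x : R -> 'M[R]_m} {X0 Zr Zq Wq : 'M[R]_m} :
  (forall Z, F Z = A Z + B) -> 0 < h -> one_sided_lipschitz ell F ->
  modeling_error F q eps_q -> modeling_error F r eps_r ->
  ode_solution F h X0 x ->
  dlra_exists F r h Zr -> dlra_exists F q h Zq -> dlra_exists F q h Wq ->
  fnorm (x h - (dlra_flow F r h Zr + dlra_flow F q h Wq - dlra_flow F q h Zq))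
    <= expR (ell * h) * fnorm (X0 - (Zr + Wq - Zq))
       + (2 * eps_q + eps_r)
         * \int[lebesgue_measure]_(s in `[0, h]) expR (ell * (h - s)).
Proof.
move=> hF h0 hell mq mr [x0 cx dx].
move=> /dlra_flowP[yr [Mr [yr0 cyr dyr]] ->].
move=> /dlra_flowP[yq [Mq [yq0 cyq dyq]] ->].
move=> /dlra_flowP[wq [Nq [wq0 cwq dwq]] ->].
have in0h : 0 <= (0 : R) <= h by rewrite lexx ltW.
have eq0 := modeling_error_ge0 mq (Mq 0 in0h).
have er0 := modeling_error_ge0 mr (Mr 0 in0h).
pose D := x - (yr + wq - yq).
pose P p (Z : 'M[R]_m) := tangent_proj p Z (F Z).
pose D' t := F (x t) - (P r (yr t) + P q (wq t) - P q (yq t)).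
rewrite -x0 -yr0 -yq0 -wq0.
apply: (@gronwall _ _ D D') => //.
- by rewrite addr_ge0// mulr_ge0.
- move=> t.
  exact: (continuousB (cx t)
    (continuousB (continuousD (cyr t) (cwq t)) (cyq t))).
- move=> t th; apply: is_deriveB; first exact: dx.
  apply: is_deriveB; last exact: dyq.
  by apply: is_deriveD; [exact: dyr|exact: dwq].
move=> t th.
have th' : 0 <= t <= h by case/andP: th => t0 t1; rewrite !ltW.
pose res p (Z : 'M[R]_m) := F Z - P p Z.
have D'E : D' t = A (D t) + (res r (yr t) + res q (wq t) - res q (yq t)).
  rewrite /D' /res /D !fctE !hF !(linearB, linearD) /=.
  apply/matrixP => i j; rewrite !mxE; ring.
rewrite D'E finnerDr; apply: lerD.
  (* For affine F, comparing D with 0 turns the one-sided Lipschitz condition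
     into a bound on the quadratic form of A. *)
  have := hell (D t) 0.
  by rewrite !subr0 !hF raddf0 add0r addrK.
apply: le_trans (finner_le _ _) _; rewrite mulrC ler_wpM2r ?fnorm_ge0//.
apply: le_trans (fnormB _ _) _.
have := fnormD (res r (yr t)) (res q (wq t)).
have := mr _ (Mr _ th'); have := mq _ (Mq _ th'); have := mq _ (Nq _ th').
rewrite -!/(P _ _) -!/(res _ _); lra.
Qed.

(** * The recursion for the error norms *)

Lemma le_max_steps {R : realType} {N n : nat} (f : nat -> R) :
  (n <= N)%N -> f n <= max_steps N f.
Proof.
rewrite -ltnS => nN.
exact: (le_bigmax _ (fun i : 'I_N.+1 => f i) (Ordinal nN)).
Qed.

(** The majorant rho^i M + K, with rho = a + b rho and K = (a + b) K + k, is
    invariant under the recursion.  The row n = 0 is a separate hypothesis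
    because the recursion never reaches it. *)
Lemma parareal_recursion_bound {R : realType} {N : nat} {e : nat -> nat -> R}
    {a b k : R} :
  0 <= a -> 0 <= b -> a + b < 1 -> (forall n i, 0 <= e n i) ->
  (forall i, e 0%N i <= k / (1 - a - b)) ->
  (forall n i, (n < N)%N -> e n.+1 i.+1 <= a * e n i + b * e n i.+1 + k) ->
  forall i, max_steps N (e ^~ i) <=
    (a / (1 - b)) ^+ i * max_steps N (e ^~ 0%N) + k / (1 - a - b).
Proof.
move=> a0 b0 ab1 e0 init step.
have b1 : 0 < 1 - b by lra.
have d0 : 0 < 1 - a - b by lra.
set K := k / (1 - a - b); set rho := a / (1 - b).
set M := max_steps N (e ^~ 0%N).
have K0 : 0 <= K by apply: le_trans (e0 0%N 0%N) (init _).
have kE : k = K * (1 - a - b) by rewrite /K divfK// gt_eqF.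
have rhoE : rho * (1 - b) = a by rewrite /rho divfK// gt_eqF.
have rho0 : 0 <= rho by rewrite divr_ge0// ltW.
have M0 : 0 <= M by apply: le_trans (e0 0%N 0%N) _;
  exact: (le_max_steps (e ^~ 0%N)).
suff H i n : (n <= N)%N -> e n i <= rho ^+ i * M + K.
  move=> i; apply: bigmax_le => [|n _]; last by apply: H; rewrite -ltnS.
  by rewrite addr_ge0// mulr_ge0// exprn_ge0.
elim: i n => [n nN|i IHi].
  rewrite expr0 mul1r; apply: le_trans (le_max_steps (e ^~ 0%N) nN) _.
  by rewrite lerDl.
elim=> [_|n IHn nN].
  apply: le_trans (init _) _.
  by rewrite lerDr mulr_ge0// exprn_ge0.
apply: le_trans (step _ _ nN) _.
have := ler_wpM2l a0 (IHi _ (ltnW nN)); have := ler_wpM2l b0 (IHn (ltnW nN)).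
rewrite exprS; set p := rho ^+ i => h1 h2.
have : rho * p * M = a * (p * M) + b * (rho * p * M) by rewrite -rhoE; ring.
rewrite kE; lra.
Qed.

(** * Linear convergence of low-rank Parareal *)

Theorem theorem3p3 (R : realType) (m : nat)
    (* the affine problem X' = F(X) on [0, N h] *)
    (F : 'M[R]_m -> 'M[R]_m) (A : {linear 'M[R]_m -> 'M[R]_m}) (B : 'M[R]_m)
    (h : R) (N : nat) (X0 : 'M[R]_m) (X : R -> 'M[R]_m)
    (hF : forall Z, F Z = A Z + B)
    (hh : 0 < h)
    (hX : ode_solution F (N%:R * h) X0 X)
    (* the DLRA assumptions *)
    (q r : nat) (L ell eps_q eps_r : R)
    (hqr : (q < r)%N)
    (hL : flipschitz setT L F)
    (hell : one_sided_lipschitz ell F)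
    (heps_q : modeling_error F q eps_q)
    (heps_r : modeling_error F r eps_r)
    (* low-rank Parareal *)
    (Tr : nat -> 'M[R]_m -> 'M[R]_m)
    (hTr : forall p Z, truncated_svd p Z (Tr p Z))
    (Y0 : 'M[R]_m) (Pert : nat -> 'M[R]_m) (Y : nat -> nat -> 'M[R]_m)
    (hY : lowrank_parareal F Tr q r h N Y0 Pert Y)
    (* Lipschitz constants of the truncations, on any set D that contains the
       exact values X_n and the iterates *)
    (D : set 'M[R]_m) (C_rq C_q : R)
    (hDX : forall n, (n <= N)%N -> D (X (n%:R * h)))
    (hDY : forall n k, (n <= N)%N -> D (Y n k))
    (hC_rq : flipschitz D C_rq (fun Z => Tr r Z - Tr q Z))
    (hC_q : flipschitz D C_q (Tr q)) :
  let Xn n := X (n%:R * h) in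
  let E n k := Xn n - Y n k in
  let alpha := expR (ell * h) * C_rq in
  let beta := expR (ell * h) * C_q in
  let kappa :=
    expR (ell * h) * max_steps N (fun n => fnorm (Xn n - Tr r (Xn n)))
    + (2 * eps_q + eps_r)
      * \int[lebesgue_measure]_(s in `[0, h]) expR (ell * (h - s)) in
  alpha + beta < 1 ->
  (* the error of the initial value, which the iteration never changes; this
     holds in particular when Y0 = X0 *)
  fnorm (X0 - Y0) <= kappa / (1 - alpha - beta) ->
  forall k : nat,
    max_steps N (fun n => fnorm (E n k)) <=
    (alpha / (1 - beta)) ^+ k * max_steps N (fun n => fnorm (E n 0%N))
    + kappa / (1 - alpha - beta).
Proof.
move=> Xn E alpha beta kappa ab1 init.
have ex0 := expR_ge0 (ell * h).
have [Crq0 CrqP] := hC_rq; have [Cq0 CqP] := hC_q.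
have X00 : X 0 = X0 by case: hX.
apply: (@parareal_recursion_bound _ N (fun n k => fnorm (E n k))) => //.
- exact: mulr_ge0.
- exact: mulr_ge0.
- by move=> n i; exact: fnorm_ge0.
- by move=> i; rewrite /E /Xn mul0r X00 (parareal_init hY).
move=> n k nN.
have [exq exr] := parareal_defined hY k nN.
have [exq' _] := parareal_defined hY k.+1 nN.
have solX : ode_solution F h (Xn n) (fun t => X (n%:R * h + t)).
  apply: ode_solution_shift hX; first by rewrite mulr_ge0// ltW.
  by rewrite -[X in _ + X]mul1r -mulrDl natr1 ler_wpM2r ?ler_nat// ltW.
have XS : X (n%:R * h + h) = Xn n.+1.
  by rewrite /Xn -natr1 mulrDl mul1r.
have := parareal_defect_le hF hh hell heps_q heps_r solX exr exq exq'.
rewrite XS -(parareal_iter hY)//.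
move/le_trans; apply.
rewrite /kappa addrA lerD2r /alpha /beta -!mulrA -!mulrDr ler_wpM2l//.
set Mx := max_steps _ _.
have trunc : fnorm (Xn n - Tr r (Xn n)) <= Mx.
  exact: (le_max_steps (fun i => fnorm (Xn i - Tr r (Xn i))) (ltnW nN)).
have DX := hDX n (ltnW nN).
have := CrqP _ _ DX (hDY n k (ltnW nN)).
have := CqP _ _ DX (hDY n k.+1 (ltnW nN)).
(* Add and subtract Tr r (Xn n) and Tr q (Xn n), so that only Tr r - Tr q and
   Tr q, whose Lipschitz constants are known, are differenced. *)
have -> : Xn n - (Tr r (Y n k) + Tr q (Y n k.+1) - Tr q (Y n k)) =
    (Xn n - Tr r (Xn n)) + ((Tr r (Xn n) - Tr q (Xn n))
     - (Tr r (Y n k) - Tr q (Y n k))) + (Tr q (Xn n) - Tr q (Y n k.+1)).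
  by apply/matrixP => i j; rewrite !mxE; ring.
move=> h1 h2; apply: le_trans (fnormD _ _) _.
have := fnormD (Xn n - Tr r (Xn n)) ((Tr r (Xn n) - Tr q (Xn n))
     - (Tr r (Y n k) - Tr q (Y n k))).
rewrite /E -/(Xn n) in h1 h2 *; lra.
Qed.
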